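(* For $\tilde\varkappa>0$, in the $(\tilde v,\tilde p)$-plane consider the dimensionless Hugoniot curve with center $(1,1)$ for a polytropic gas with $\gamma=2$, $$(\tilde v\tilde p-1)+\frac12(\tilde p+1)(\tilde v-1)+\frac{\tilde\varkappa^2}{2}\,\frac{(\tilde v^2\tilde p^2-1)(\tilde v-1)}{\tilde p-1}=0 ,$$ and its thermal branch $$\tilde g(\tilde v)=\tilde p^-(\tilde v)=\frac{\tilde v+1-(1-\tilde v)\sqrt{\tilde\varkappa^4\tilde v^2+\tilde\varkappa^2(\tilde v-1)^2+4}}{\tilde v\big(\tilde\varkappa^2(\tilde v-1)\tilde v+3\big)-1}.$$ Then $$\tilde g''(1)=\frac12\left(\frac{2\tilde\varkappa^4}{\sqrt{\tilde\varkappa^4+4}}-4\tilde\varkappa^2+(\tilde\varkappa^2+3)^2-(\tilde\varkappa^2+3)\big(\sqrt{\tilde\varkappa^4+4}+1\big)\right),$$ and there is $\tilde\varkappa_c>0$, $\tilde\varkappa_c=1.0399\ldots$, such that $\tilde g''(1)<0$ for $0<\tilde\varkappa<\tilde\varkappa_c$ and $\tilde g''(1)>0$ for $\tilde\varkappa>\tilde\varkappa_c$. Moreover, for $0<\tilde\varkappa<\tilde\varkappa_c$ there exists $\tilde v_{max}>1$ such that along the thermal branch $$\tilde\Psi(\tilde v)=\tilde\eta-\frac{\tilde\varkappa^2}{\tilde{\mathcal{M}}^2}(\tilde\theta-1)>0\qquad\text{for all }\tilde v\in\,]1,\tilde v_{max}[\,,$$ i.e. the Clausius–Duhem inequality $\tilde\Psi\ge0$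 is satisfied by expansion shocks on this branch.
   Context: $\tilde v=v/v_0$ and $\tilde p=p/p_0$ are specific volume and pressure scaled by those of the state $(v_0,p_0)$ ahead of the shock. For $\gamma=2$, along the branch $\tilde p=\tilde p^-(\tilde v)$: $\tilde\theta=\tilde v\tilde p$ (dimensionless temperature, equal to $1$ at the center), $\tilde\eta=\log(\tilde p\,\tilde v^2)$ (dimensionless entropy, equal to $0$ at the center), $\tilde{\mathcal{M}}^2=-\dfrac{\tilde p-1}{\tilde v-1}$. An expansion shock is one for which the state behind the front has $\tilde v>1$ (lower density than the state ahead). *)

(* Defs.v *)
From Stdlib Require Import Reals.
From Coquelicot Require Import Coquelicot.

Local Open Scope R_scope.

(* All quantities are dimensionless and gamma = 2; [k] is the parameter
   varkappa, [v] the specific volume and [p] the pressure. *)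

Definition hugoniot_lhs (k v p : R) : R :=
  (v * p - 1) + / 2 * (p + 1) * (v - 1)
  + k ^ 2 / 2 * ((v ^ 2 * p ^ 2 - 1) * (v - 1) / (p - 1)).

(* The equation makes sense only for p <> 1 (division is total here); the center
   (1,1), where its last term is indeterminate, belongs to the curve by
   convention. *)
Definition hugoniot_curve (k v p : R) : Prop :=
  (v = 1 /\ p = 1) \/ (p <> 1 /\ hugoniot_lhs k v p = 0).

Definition branch_den (k v : R) : R :=
  v * (k ^ 2 * (v - 1) * v + 3) - 1.

(* p^-(v), written g in terms of v *)
Definition thermal_branch (k v : R) : R :=
  (v + 1 - (1 - v) * sqrt (k ^ 4 * v ^ 2 + k ^ 2 * (v - 1) ^ 2 + 4))
  / branch_den k v.

Definition temperature (v p : R) : R := v * p.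

Definition entropy (v p : R) : R := ln (p * v ^ 2).

Definition mach_sq (v p : R) : R := - ((p - 1) / (v - 1)).

Definition Psi (k v : R) : R :=
  let p := thermal_branch k v in
  entropy v p - k ^ 2 / mach_sq v p * (temperature v p - 1).

(* Main.v *)
Require Import Defs.
From Stdlib Require Import Reals Lra Psatz.
From Coquelicot Require Import Coquelicot.

Local Open Scope R_scope.

(** Write [a = k^2], [p] for the thermal branch and [q = (p - 1) / (v - 1)] for
    the slope of the chord from the center, so that the squared Mach number is
    [- q].

    The numerator of [p - 1] is divisible by [v - 1], so [q] has a closed form
    that is smooth through [v = 1] ([thermal_branch_slope]).
    After the trivial factors are removed, the Hugoniot equation is a quadratic
    equation in [q] ([slope_quadratic]).  Its constant term is
    [a (v + 1) > 0] for [v > 0], so [q] never vanishes: the branch lies on the Hugoniot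
    curve and meets [p = 1] only at the center.

    Since [p = 1 + (v - 1) q], [p''(1) = 2 q'(1)].
    Rationalizing twice turns this number into a positive factor times the
    increasing cubic [2 a^3 - 3 a^2 + 12 a - 12] ([curvature_factored]), whose
    only root gives the critical value of [k].

    To find the sign of Psi, differentiate it along the branch and use the Gibbs
    relation [theta d(eta) = d(theta) + p dv] together with the differentiated
    Hugoniot equation.  Everything cancels except

    [theta Psi' = - q' / (2 q^2) ((p - 1)^2 + a (theta - 1)^2)]

    ([clausius_duhem_rate]).  Hence Psi, which vanishes at the center, grows to
    the right of it as long as [q' < 0], that is, as long as the Mach number
    grows; and [q'(1)] is half the curvature. *)

(** * The slope of the chord from the center *)

Definition radical (k v : R) : R :=
  sqrt (k ^ 4 * v ^ 2 + k ^ 2 * (v - 1) ^ 2 + 4).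

Definition slope (k v : R) : R :=
  (radical k v - k ^ 2 * v ^ 2 - 2) / branch_den k v.

Lemma radicand_pos (k v : R) :
  0 < k ^ 4 * v ^ 2 + k ^ 2 * (v - 1) ^ 2 + 4.
Proof.
  assert (0 <= (k ^ 2 * v) ^ 2) by apply pow2_ge_0.
  assert (0 <= (k * (v - 1)) ^ 2) by apply pow2_ge_0.
  nra.
Qed.

Lemma radical_pos (k v : R) : 0 < radical k v.
Proof. apply sqrt_lt_R0, radicand_pos. Qed.

Lemma radical_sqr (k v : R) :
  radical k v ^ 2 = k ^ 4 * v ^ 2 + k ^ 2 * (v - 1) ^ 2 + 4.
Proof. apply pow2_sqrt, Rlt_le, radicand_pos. Qed.

Lemma radical_1 (k : R) : radical k 1 = sqrt (k ^ 4 + 4).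
Proof. unfold radical; f_equal; ring. Qed.

Lemma branch_den_1 (k : R) : branch_den k 1 = 2.
Proof. unfold branch_den; ring. Qed.

Lemma thermal_branch_slope (k v : R) :
  branch_den k v <> 0 -> thermal_branch k v = 1 + (v - 1) * slope k v.
Proof.
  intros HD; unfold thermal_branch, slope; fold (radical k v).
  apply (Rmult_eq_reg_r (branch_den k v)); [|exact HD].
  field_simplify; try exact HD.
  unfold branch_den; ring.
Qed.

(** The Hugoniot equation, cleared of the denominators [2] and [p - 1], contains
    the factor [(v - 1)^2]; the other factor is this quadratic in the slope. *)
Lemma slope_quadratic (k v : R) :
  branch_den k v <> 0 ->
  branch_den k v * slope k v ^ 2 + 2 * (k ^ 2 * v ^ 2 + 2) * slope k v
  + k ^ 2 * (v + 1) = 0.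
Proof.
  intros HD; unfold slope.
  apply (Rmult_eq_reg_r (branch_den k v)); [|exact HD].
  field_simplify; try exact HD.
  rewrite radical_sqr; unfold branch_den; ring.
Qed.

Lemma slope_neq_0 (k v : R) :
  0 < k -> 0 < v -> branch_den k v <> 0 -> slope k v <> 0.
Proof.
  intros Hk Hv HD Hq.
  pose proof (slope_quadratic k v HD) as E; rewrite Hq in E.
  assert (0 < k ^ 2 * (v + 1)) by (apply Rmult_lt_0_compat; nra).
  lra.
Qed.

(** The left-hand side of the Hugoniot equation with [(v - 1) / (p - 1)] written
    as [/ q], which also makes sense at the center. *)
Definition hugoniot_chord (k v q : R) : R :=
  let p := 1 + (v - 1) * q in
  (v * p - 1) + / 2 * (p + 1) * (v - 1) + k ^ 2 / 2 * ((v ^ 2 * p ^ 2 - 1) / q).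

Lemma hugoniot_chord_slope (k v : R) :
  0 < k -> 0 < v -> branch_den k v <> 0 ->
  hugoniot_chord k v (slope k v) = 0.
Proof.
  intros Hk Hv HD.
  pose proof (slope_quadratic k v HD) as E.
  pose proof (slope_neq_0 k v Hk Hv HD) as Hq.
  generalize dependent (slope k v); intros q E Hq.
  transitivity ((v - 1) * (branch_den k v * q ^ 2
    + 2 * (k ^ 2 * v ^ 2 + 2) * q + k ^ 2 * (v + 1)) / (2 * q)).
  - unfold hugoniot_chord, branch_den; field; exact Hq.
  - rewrite E; field; exact Hq.
Qed.

Lemma thermal_branch_on_hugoniot_curve (k v : R) :
  0 < k -> 0 < v -> branch_den k v <> 0 ->
  hugoniot_curve k v (thermal_branch k v).
Proof.
  intros Hk Hv HD.
  pose proof (hugoniot_chord_slope k v Hk Hv HD) as E.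
  pose proof (slope_neq_0 k v Hk Hv HD) as Hq.
  rewrite (thermal_branch_slope k v HD).
  destruct (Req_dec v 1) as [->|Hv1].
  - left; split; ring.
  - right.
    assert (Hp : (v - 1) * slope k v <> 0)
      by (apply Rmult_integral_contrapositive_currified; lra).
    split; [lra|].
    rewrite <- E; unfold hugoniot_lhs, hugoniot_chord.
    field; repeat split; solve [exact Hq | lra].
Qed.

(** * Derivatives at the center *)

Definition slope' (k v : R) : R :=
  (((k ^ 4 * v + k ^ 2 * (v - 1)) / radical k v - 2 * k ^ 2 * v)
     * branch_den k v
   - (radical k v - k ^ 2 * v ^ 2 - 2)
     * (3 * k ^ 2 * v ^ 2 - 2 * k ^ 2 * v + 3))
  / branch_den k v ^ 2.

Lemma is_derive_radical (k v : R) :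
  is_derive (radical k) v ((k ^ 4 * v + k ^ 2 * (v - 1)) / radical k v).
Proof.
  unfold radical; auto_derive.
  - pose proof (radicand_pos k v); simpl in *; lra.
  - match goal with |- context [/ (2 * sqrt ?x)] =>
      replace x with (k ^ 4 * v ^ 2 + k ^ 2 * (v - 1) ^ 2 + 4) by (simpl; ring)
    end.
    fold (radical k v); pose proof (radical_pos k v).
    field; lra.
Qed.

Lemma is_derive_branch_den (k v : R) :
  is_derive (branch_den k) v (3 * k ^ 2 * v ^ 2 - 2 * k ^ 2 * v + 3).
Proof. unfold branch_den; auto_derive; [trivial|ring]. Qed.

Lemma is_derive_slope (k v : R) :
  branch_den k v <> 0 -> is_derive (slope k) v (slope' k v).
Proof.
  intros HD; unfold slope, slope'.
  apply (is_derive_div (fun v => radical k v - k ^ 2 * v ^ 2 - 2)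
           (branch_den k)); [|apply is_derive_branch_den|exact HD].
  pose proof (is_derive_radical k v) as HR.
  auto_derive.
  - exact (ex_intro _ _ HR).
  - replace (Derive (fun x => radical k x) v)
      with (Derive (radical k) v) by reflexivity.
    rewrite (is_derive_unique _ _ _ HR); ring.
Qed.

Lemma continuous_slope' (k v : R) :
  branch_den k v <> 0 -> continuous (slope' k) v.
Proof.
  intros HD; apply (ex_derive_continuous (slope' k)).
  pose proof (is_derive_radical k v) as HR.
  pose proof (is_derive_branch_den k v) as HB.
  pose proof (radical_pos k v).
  unfold slope'; auto_derive; repeat split;
    solve [eexists; eassumption | lra
          | simpl; rewrite Rmult_1_r;
            apply Rmult_integral_contrapositive_currified; exact HD].
Qed.

Lemma continuous_locally_pos (f : R -> R) (x : R) :
  continuous f x -> 0 < f x -> locally x (fun y => 0 < f y).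
Proof. intros Hf Hx; apply Hf, (open_gt 0 _ Hx). Qed.

Lemma locally_branch_den_pos (k : R) :
  locally 1 (fun v => 0 < branch_den k v).
Proof.
  apply (continuous_locally_pos (branch_den k)).
  - apply (ex_derive_continuous (branch_den k)).
    eexists; apply is_derive_branch_den.
  - rewrite branch_den_1; lra.
Qed.

(** Near a point where the denominator is positive the chord formula holds on a
    whole neighbourhood, so it may be differentiated. *)
Lemma is_derive_thermal_branch (k v : R) :
  0 < branch_den k v ->
  is_derive (thermal_branch k) v (slope k v + (v - 1) * slope' k v).
Proof.
  intros HD.
  apply (is_derive_ext_loc (fun v => 1 + (v - 1) * slope k v)).
  - assert (HL : locally v (fun v => 0 < branch_den k v)).
    { apply continuous_locally_pos; [|exact HD].
      apply (ex_derive_continuous (branch_den k)).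
      eexists; apply is_derive_branch_den. }
    refine (filter_imp _ _ _ HL); intros y Hy.
    rewrite thermal_branch_slope; [reflexivity|lra].
  - pose proof (is_derive_slope k v ltac:(lra)) as Hq.
    auto_derive; [exact (ex_intro _ _ Hq)|].
    replace (Derive (fun x => slope k x) v)
      with (Derive (slope k) v) by reflexivity.
    rewrite (is_derive_unique _ _ _ Hq); ring.
Qed.

(** At its zero [x] the factor [y - x] supplies the derivative by itself, so no
    differentiability of [f] is needed. *)
Lemma is_derive_mult_vanishing (f : R -> R) (x : R) :
  continuous f x -> is_derive (fun y => (y - x) * f y) x (f x).
Proof.
  intros Hf; apply is_derive_Reals; intros eps Heps.
  destruct (proj1 (filterlim_locally f (f x)) Hf (mkposreal eps Heps))
    as [d Hd].
  exists d; intros h Hh0 Hh.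
  replace (((x + h - x) * f (x + h) - (x - x) * f x) / h - f x)
    with (f (x + h) - f x) by (field; exact Hh0).
  apply Hd.
  replace (ball x d (x + h)) with (Rabs (x + h - x) < d) by reflexivity.
  replace (x + h - x) with h by ring; exact Hh.
Qed.

Definition curvature (k : R) : R :=
  / 2 * (2 * k ^ 4 / sqrt (k ^ 4 + 4) - 4 * k ^ 2 + (k ^ 2 + 3) ^ 2
         - (k ^ 2 + 3) * (sqrt (k ^ 4 + 4) + 1)).

Lemma slope'_1 (k : R) : slope' k 1 = curvature k / 2.
Proof.
  pose proof (radical_pos k 1) as HS.
  unfold slope', curvature; rewrite branch_den_1, <- radical_1.
  field; lra.
Qed.

Lemma is_derive_2_thermal_branch (k : R) :
  is_derive_n (thermal_branch k) 2 1 (curvature k).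
Proof.
  change (is_derive (fun v => Derive (thermal_branch k) v) 1 (curvature k)).
  apply (is_derive_ext_loc (fun v => slope k v + (v - 1) * slope' k v)).
  - refine (filter_imp _ _ _ (locally_branch_den_pos k)); intros v HD.
    symmetry; apply is_derive_unique, is_derive_thermal_branch, HD.
  - assert (HD : branch_den k 1 <> 0) by (rewrite branch_den_1; lra).
    replace (curvature k) with (slope' k 1 + slope' k 1)
      by (rewrite slope'_1; field).
    apply (is_derive_plus (slope k) (fun v => (v - 1) * slope' k v)).
    + apply is_derive_slope, HD.
    + apply is_derive_mult_vanishing, continuous_slope', HD.
Qed.

(** * The sign of the curvature *)

Definition critical_cubic (a : R) : R := 2 * a ^ 3 - 3 * a ^ 2 + 12 * a - 12.

Lemma critical_cubic_increasing (a b : R) :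
  a < b -> critical_cubic a < critical_cubic b.
Proof.
  intros H; unfold critical_cubic.
  (* the divided difference is the positive definite form below *)
  assert (0 < 2 * (a ^ 2 + a * b + b ^ 2) - 3 * (a + b) + 12).
  { pose proof (pow2_ge_0 (a + b - 2)); pose proof (pow2_ge_0 a).
    pose proof (pow2_ge_0 b); nra. }
  assert (0 < (b - a) * (2 * (a ^ 2 + a * b + b ^ 2) - 3 * (a + b) + 12))
    by (apply Rmult_lt_0_compat; lra).
  nra.
Qed.

(** With [a = k^2] and [S = sqrt (a^2 + 4)], multiplying [a + 2 - S] by its
    conjugate extracts a factor [a] and leaves [(a + 2) S - (a^2 - 2 a + 8)];
    multiplying this by its conjugate gives four times the cubic. *)
Lemma curvature_factored (k : R) :
  0 < k ->
  exists c, 0 < c /\ curvature k = c * critical_cubic (k ^ 2).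
Proof.
  intros Hk; unfold curvature.
  pose proof (radical_pos k 1) as HS; pose proof (radical_sqr k 1) as HS2.
  rewrite radical_1 in HS, HS2.
  set (S := sqrt (k ^ 4 + 4)) in *.
  replace (k ^ 4) with ((k ^ 2) ^ 2) in * by ring.
  assert (Ha : 0 < k ^ 2) by (apply pow_lt, Hk).
  set (a := k ^ 2) in *; clearbody a S.
  assert (HS2' : S ^ 2 = a ^ 2 + 4) by (rewrite HS2; ring); clear HS2.
  assert (H1 : 0 < a + 2 + S) by lra.
  assert (H2 : 0 < (a + 2) * S + (a ^ 2 - 2 * a + 8))
    by (pose proof (pow2_ge_0 (a - 1)); nra).
  exists (4 * a / (S * (a + 2 + S) * ((a + 2) * S + (a ^ 2 - 2 * a + 8)))).
  split.
  - apply Rdiv_lt_0_compat; [lra|].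
    repeat apply Rmult_lt_0_compat; assumption.
  - assert (E1 : a + 2 - S = 4 * a / (a + 2 + S)).
    { apply (Rmult_eq_reg_r (a + 2 + S)); [|lra].
      field_simplify; [rewrite HS2'; ring|lra]. }
    assert (E2 : (a + 2) * S - (a ^ 2 - 2 * a + 8)
      = 4 * critical_cubic a / ((a + 2) * S + (a ^ 2 - 2 * a + 8))).
    { apply (Rmult_eq_reg_r ((a + 2) * S + (a ^ 2 - 2 * a + 8))); [|lra].
      transitivity (4 * critical_cubic a); [|field; lra].
      transitivity ((a + 2) ^ 2 * S ^ 2 - (a ^ 2 - 2 * a + 8) ^ 2); [ring|].
      rewrite HS2'; unfold critical_cubic; ring. }
    transitivity (/ 2 * (2 * a ^ 2 / S - 4 * a + (a + 3) * (a + 2 - S))).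
    { field; lra. }
    rewrite E1.
    transitivity (a * ((a + 2) * S - (a ^ 2 - 2 * a + 8))
                  / (S * (a + 2 + S))).
    { transitivity (a * (2 * a ^ 2 + 4 * a + 2 * a * S + 4 * S - 4 * S ^ 2)
                  / (2 * S * (a + 2 + S))); [field; lra|].
      rewrite HS2'; field; lra. }
    rewrite E2; field; repeat split; lra.
Qed.

Lemma critical_parameter :
  exists kc, 1.0399 <= kc < 1.04 /\ critical_cubic (kc ^ 2) = 0.
Proof.
  destruct (IVT (fun k => critical_cubic (k ^ 2)) 1.0399 1.04) as [kc [Hkc H0]].
  - intros x; apply derivable_continuous_pt.
    apply ex_derive_Reals_0; unfold critical_cubic; auto_derive; trivial.
  - lra.
  - unfold critical_cubic; lra.
  - unfold critical_cubic; lra.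
  - exists kc; repeat split; [lra| |exact H0].
    destruct (Req_dec kc 1.04) as [->|]; [|lra].
    unfold critical_cubic in H0; lra.
Qed.

Lemma curvature_neg (k kc : R) :
  critical_cubic (kc ^ 2) = 0 -> 0 < k < kc -> curvature k < 0.
Proof.
  intros H0 Hk; destruct (curvature_factored k) as [c [Hc ->]]; [lra|].
  assert (critical_cubic (k ^ 2) < critical_cubic (kc ^ 2))
    by (apply critical_cubic_increasing; nra).
  nra.
Qed.

Lemma curvature_pos (k kc : R) :
  critical_cubic (kc ^ 2) = 0 -> 0 < kc < k -> 0 < curvature k.
Proof.
  intros H0 Hk; destruct (curvature_factored k) as [c [Hc ->]]; [lra|].
  assert (critical_cubic (kc ^ 2) < critical_cubic (k ^ 2))
    by (apply critical_cubic_increasing; nra).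
  nra.
Qed.

(** * The Clausius-Duhem function along the branch *)

(** Psi in terms of the chord slope [q]: this form is differentiable through the
    center, where the quotient defining the Mach number is [0 / 0]. *)
Definition psi_chord (k v q : R) : R :=
  let p := 1 + (v - 1) * q in
  entropy v p + k ^ 2 / q * (temperature v p - 1).

Lemma Psi_chord (k v : R) :
  v <> 1 -> branch_den k v <> 0 -> slope k v <> 0 ->
  Psi k v = psi_chord k v (slope k v).
Proof.
  intros Hv HD Hq; unfold Psi, psi_chord, mach_sq.
  rewrite (thermal_branch_slope k v HD).
  field; repeat split; try lra.
  intros E; destruct (Rmult_integral ((v - 1)) (slope k v)); lra.
Qed.

(** For [theta = v p], the Gibbs relation [theta d(eta) = d(theta) + p dv] makes
    [theta] times the derivative of Psi equal to the derivative of the Hugoniot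
    function, which vanishes, plus the multiple of [dq] below. *)
Lemma clausius_duhem_rate (k v dq : R) (q : R -> R) :
  0 < v -> 0 < 1 + (v - 1) * q v -> q v <> 0 ->
  is_derive q v dq ->
  locally v (fun y => hugoniot_chord k y (q y) = 0) ->
  is_derive (fun y => psi_chord k y (q y)) v
    (- dq / (2 * q v ^ 2)
     * (((v - 1) * q v) ^ 2 + k ^ 2 * (v * (1 + (v - 1) * q v) - 1) ^ 2)
     / (v * (1 + (v - 1) * q v))).
Proof.
  intros Hv Hp Hq Hdq HH.
  assert (Eq : Derive (fun y => q y) v = dq)
    by exact (is_derive_unique _ _ _ Hdq).
  assert (ex : ex_derive (fun y => q y) v) by (eexists; exact Hdq).
  assert (HdH : is_derive (fun y => hugoniot_chord k y (q y)) v 0).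
  { apply (is_derive_ext_loc (fun _ => 0));
      [|apply (@is_derive_const R_AbsRing)].
    refine (filter_imp _ _ _ HH); intros y ->; reflexivity. }
  pose (p := 1 + (v - 1) * q v); pose (dp := q v + (v - 1) * dq).
  assert (HdH' : is_derive (fun y => hugoniot_chord k y (q y)) v
    (p + v * dp + / 2 * (dp * (v - 1) + (p + 1))
     + k ^ 2 / 2 * ((2 * v * p * (p + v * dp) * q v
                     - (v ^ 2 * p ^ 2 - 1) * dq) / q v ^ 2))).
  { unfold hugoniot_chord; auto_derive.
    - repeat split; assumption.
    - rewrite Eq; unfold p, dp; field; exact Hq. }
  pose proof (is_derive_unique _ _ _ HdH') as E.
  rewrite (is_derive_unique _ _ _ HdH) in E.
  unfold psi_chord, entropy, temperature; auto_derive.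
  - repeat split; try assumption.
    apply Rmult_lt_0_compat; [exact Hp|nra].
  - rewrite Eq.
    change (v + - (1)) with (v - 1).
    fold p; change (0 < p) in Hp.
    apply (Rmult_eq_reg_r (v * p));
      [|apply Rgt_not_eq, Rmult_lt_0_compat; assumption].
    match goal with |- ?l = ?r => cut (l - r = 0); [lra|] end.
    rewrite E; unfold dp; subst p.
    field; repeat split; lra.
Qed.

Lemma slope_1_neg (k : R) : 0 < k -> slope k 1 < 0.
Proof.
  intros Hk; unfold slope; rewrite branch_den_1.
  pose proof (radical_pos k 1); pose proof (radical_sqr k 1).
  assert (0 < k ^ 2) by (apply pow_lt, Hk).
  nra.
Qed.

(** All signs used by the monotonicity argument hold at the center, hence near
    it. *)
Lemma locally_decreasing_chord (k : R) :
  0 < k -> curvature k < 0 ->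
  locally 1 (fun v => 0 < v /\ 0 < branch_den k v /\ slope k v < 0
                      /\ 0 < 1 + (v - 1) * slope k v /\ slope' k v < 0).
Proof.
  intros Hk Hc.
  assert (HD : branch_den k 1 <> 0) by (rewrite branch_den_1; lra).
  assert (Hcq : continuous (slope k) 1).
  { apply (ex_derive_continuous (slope k)).
    eexists; apply is_derive_slope, HD. }
  repeat apply filter_and.
  - apply (continuous_locally_pos (fun v => v)); [apply continuous_id|lra].
  - apply locally_branch_den_pos.
  - refine (filter_imp _ _ _
              (continuous_locally_pos (fun v => - slope k v) 1 _ _)).
    + intros v Hv; lra.
    + apply (continuous_opp (slope k)), Hcq.
    + pose proof (slope_1_neg k Hk); lra.
  - apply (continuous_locally_pos (fun v => 1 + (v - 1) * slope k v)); [|lra].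
    apply (ex_derive_continuous (fun v => 1 + (v - 1) * slope k v)).
    auto_derive; eexists; apply is_derive_slope, HD.
  - refine (filter_imp _ _ _
              (continuous_locally_pos (fun v => - slope' k v) 1 _ _)).
    + intros v Hv; lra.
    + apply (continuous_opp (slope' k)), continuous_slope', HD.
    + rewrite slope'_1; lra.
Qed.

Lemma expansion_shocks_admissible (k : R) :
  0 < k -> curvature k < 0 ->
  exists vmax : R, 1 < vmax /\
    forall v : R, 1 < v < vmax ->
      0 < thermal_branch k v /\
      0 < mach_sq v (thermal_branch k v) /\
      0 < Psi k v.
Proof.
  intros Hk Hc.
  destruct (locally_locally _ _ (locally_decreasing_chord k Hk Hc))
    as [d Hnear].
  pose proof (fun y By => locally_singleton _ _ (Hnear y By)) as Hd.
  exists (1 + d); split; [pose proof (cond_pos d); lra|intros v Hv].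
  assert (Hball : forall y, 1 <= y <= v -> ball 1 d y).
  { intros y Hy; change (Rabs (y - 1) < d).
    rewrite Rabs_pos_eq; lra. }
  destruct (Hd v (Hball v ltac:(lra))) as (Hv0 & HD & Hq & Hp & _).
  rewrite Psi_chord; try lra.
  rewrite thermal_branch_slope; try lra.
  split; [exact Hp|split].
  { unfold mach_sq.
    replace (- ((1 + (v - 1) * slope k v - 1) / (v - 1))) with (- slope k v)
      by (field; lra).
    lra. }
  pose (rate := fun y => - slope' k y / (2 * slope k y ^ 2)
     * (((y - 1) * slope k y) ^ 2
        + k ^ 2 * (y * (1 + (y - 1) * slope k y) - 1) ^ 2)
     / (y * (1 + (y - 1) * slope k y))).
  assert (Hrate : forall y, 1 <= y <= v ->
    is_derive (fun y => psi_chord k y (slope k y)) y (rate y)).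
  { intros y Hy; pose proof (Hball y Hy) as By.
    destruct (Hd y By) as (Hy0 & HDy & Hqy & Hpy & _).
    apply clausius_duhem_rate; try lra.
    - apply is_derive_slope; lra.
    - refine (filter_imp _ _ _ (Hnear y By)).
      intros z (Hz0 & HDz & _).
      apply hugoniot_chord_slope; lra. }
  assert (Hcenter : psi_chord k 1 (slope k 1) = 0).
  { unfold psi_chord, entropy, temperature.
    replace ((1 + (1 - 1) * slope k 1) * 1 ^ 2) with 1 by ring.
    rewrite ln_1; field.
    pose proof (slope_1_neg k Hk); lra. }
  destruct (MVT_cor2 (fun y => psi_chord k y (slope k y)) rate 1 v)
    as [c [Heq Hcv]]; [lra| |].
  { intros y Hy; apply is_derive_Reals, Hrate, Hy. }
  rewrite Hcenter, Rminus_0_r in Heq; rewrite Heq.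
  apply Rmult_lt_0_compat; [|lra].
  destruct (Hd c (Hball c ltac:(lra))) as (Hc0 & _ & Hqc & Hpc & Hdc).
  apply Rdiv_lt_0_compat; [|apply Rmult_lt_0_compat; lra].
  apply Rmult_lt_0_compat.
  - apply Rdiv_lt_0_compat; nra.
  - (* [c > 1] makes the first square positive *)
    assert (0 < ((c - 1) * slope k c) ^ 2) by (apply pow2_gt_0; nra).
    assert (0 <= k ^ 2 * (c * (1 + (c - 1) * slope k c) - 1) ^ 2)
      by (apply Rmult_le_pos; apply pow2_ge_0).
    lra.
Qed.

Theorem mainTheorem6 :
  (forall k v : R, 0 < k -> 0 < v -> branch_den k v <> 0 ->
     hugoniot_curve k v (thermal_branch k v))
  /\
  (forall k : R, 0 < k ->
     locally 1 (fun v => ex_derive (thermal_branch k) v) /\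
     is_derive_n (thermal_branch k) 2 1
       (/ 2 * (2 * k ^ 4 / sqrt (k ^ 4 + 4) - 4 * k ^ 2 + (k ^ 2 + 3) ^ 2
               - (k ^ 2 + 3) * (sqrt (k ^ 4 + 4) + 1))))
  /\
  (exists kc : R,
     0 < kc /\ 1.0399 <= kc < 1.04 /\
     (forall k : R, 0 < k < kc -> Derive_n (thermal_branch k) 2 1 < 0) /\
     (forall k : R, kc < k -> 0 < Derive_n (thermal_branch k) 2 1) /\
     (forall k : R, 0 < k < kc ->
        exists vmax : R, 1 < vmax /\
          forall v : R, 1 < v < vmax ->
            (* the state is physical, so that Psi is well defined *)
            0 < thermal_branch k v /\
            0 < mach_sq v (thermal_branch k v) /\
            0 < Psi k v)).
Proof.
  split; [exact thermal_branch_on_hugoniot_curve|split].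
  - intros k _; split; [|apply is_derive_2_thermal_branch].
    refine (filter_imp _ _ _ (locally_branch_den_pos k)); intros v HD.
    eexists; apply is_derive_thermal_branch, HD.
  - destruct critical_parameter as [kc [Hkc H0]].
    exists kc; split; [lra|split; [exact Hkc|split; [|split]]]; intros k Hk.
    + rewrite (is_derive_n_unique _ _ _ _ (is_derive_2_thermal_branch k)).
      exact (curvature_neg k kc H0 Hk).
    + rewrite (is_derive_n_unique _ _ _ _ (is_derive_2_thermal_branch k)).
      apply (curvature_pos k kc H0); lra.
    + apply expansion_shocks_admissible; [lra|].
      exact (curvature_neg k kc H0 Hk).
Qed.
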